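(* Let $(X,f_{1,\infty})$ be a non-autonomous discrete dynamical system. Then the following are equivalent: (i) The system $(X,f_{1,\infty})$ is strongly exact transitive. (ii) For every pair of opene sets $U,V\subset X$, $\bigcup_{n\in\mathbb{N}}(f_1^n\times f_1^n)(U\times V)$ contains the diagonal $Id_X=\{(x,x):x\in X\}$. (iii) For every $x\in X$, the negative orbit $O^-_{f_{1,\infty}\times f_{1,\infty}}(x,x)$ is dense in $X\times X$. (iv) For every $x\in X$ and all opene subsets $U,V\subset X$, there exists $N\in\mathbb{N}$ such that $x\in f_1^N(U)\cap f_1^N(V)$.
   Context: $\mathbb{N}=\{1,2,3,\dots\}$. A non-autonomous discrete dynamical system (NDDS) is a pair $(X,f_{1,\infty})$ where $X$ is a compact metric space and $f_{1,\infty}=(f_n)_{n\in\mathbb{N}}$ is a sequence of continuous maps $f_n:X\to X$. For $n\in\mathbb{N}$, $f_1^n:=f_n\circ\cdots\circ f_1$. ''Opene'' means nonempty and open. The system is strongly exact transitive if for every pair of opene sets $U,V\subset X$, $\bigcup_{n=1}^\infty (f_1^n(U)\cap f_1^n(V))=X$. The negative orbit of $(x,x)$ under the product system $(X\times X, f_{1,\infty}\times f_{1,\infty})$, where $f_{1,\infty}\times f_{1,\infty}=(f_n\times f_n)_{n\in\mathbb{N}}$, is $O^-_{f_{1,\infty}\times f_{1,\infty}}(x,x)=\{(y,z)\in X\times X:\ f_1^n(y)=x \text{ and } f_1^n(z)=x\text{ for some }n\in\mathbb{N}\}$. *)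

(* Defs.v *)
From mathcomp Require Import all_boot all_order all_algebra.
From mathcomp Require Import all_classical all_reals all_analysis.

Set Implicit Arguments.
Unset Strict Implicit.
Unset Printing Implicit Defensive.

Local Open Scope classical_set_scope.

(* A sequence of maps (f_n) with n = 1, 2, 3, ... is represented by a function
   on nat whose value at 0 is never used. *)

(* compose f n is f_1^n = f_n \o ... \o f_1. *)
Fixpoint compose (X : Type) (f : nat -> X -> X) (n : nat) : X -> X :=
  if n is m.+1 then f m.+1 \o compose f m else id.

Definition prod_fun (X Y : Type) (g : X -> X) (h : Y -> Y) (z : X * Y) : X * Y :=
  (g z.1, h z.2).

Definition prod_seq (X Y : Type) (f : nat -> X -> X) (g : nat -> Y -> Y)
  (n : nat) : X * Y -> X * Y := prod_fun (f n) (g n).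

Definition opene (X : topologicalType) (U : set X) : Prop :=
  U !=set0 /\ open U.

Definition strongly_exact_transitive (X : topologicalType)
    (f : nat -> X -> X) : Prop :=
  forall U V : set X, opene U -> opene V ->
    \bigcup_(n >= 1) ((compose f n @` U) `&` (compose f n @` V)) = [set: X].

Definition negative_orbit (X : Type) (f : nat -> X -> X) (x : X) : set X :=
  [set y | exists n : nat, (1 <= n)%N /\ compose f n y = x].

Lemma compose_prod_seq (X Y : Type) (f : nat -> X -> X) (g : nat -> Y -> Y)
    (n : nat) :
  compose (prod_seq f g) n = prod_fun (compose f n) (compose g n).
Proof.
apply/funext; elim: n => [|n IHn] [y z] //=.
by rewrite IHn.
Qed.

Lemma negative_orbit_prod_seq (X : Type) (f : nat -> X -> X) (x : X) :
  negative_orbit (prod_seq f f) (x, x) =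
  [set p | exists n : nat,
     (1 <= n)%N /\ compose f n p.1 = x /\ compose f n p.2 = x].
Proof.
apply/seteqP; split=> p /= [n [n1]]; rewrite ?compose_prod_seq.
  by case=> py pz; exists n.
by case=> py pz; exists n; rewrite compose_prod_seq /prod_fun py pz.
Qed.

(* Main.v *)
Require Import Defs.
From mathcomp Require Import all_boot all_order all_algebra.
From mathcomp Require Import all_classical all_reals all_analysis.

Local Open Scope classical_set_scope.

(** Each condition says that for all [x] and opene [U], [V] some single time [n >= 1] has points [u]
    in [U] and [v] in [V], both sent to [x] by [compose f n]. The cycle of implications mostly
    unfolds this. The only topology is that open boxes form a base of the product, so density of the
    negative orbit need only be tested on boxes [U]*[V]. *)

Theorem theorem3p9 (R : realType) (X : metricType R)
    (X_compact : compact [set: X])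
    (f : nat -> X -> X)
    (f_cont : forall n : nat, (1 <= n)%N -> continuous (f n)) :
  [<-> strongly_exact_transitive f;
       forall U V : set X, opene U -> opene V ->
         diagonal `<=`
           \bigcup_(n >= 1) (prod_fun (compose f n) (compose f n) @` (U `*` V));
       forall x : X, dense (negative_orbit (prod_seq f f) (x, x));
       forall (x : X) (U V : set X), opene U -> opene V ->
         exists N : nat, (1 <= N)%N /\
           ((compose f N @` U) `&` (compose f N @` V)) x].
Proof.
tfae.
- move=> fT U V oU oV [x y]; rewrite /diagonal/= => <-.
  have : [set: X] x by [].
  rewrite -(fT U V oU oV) => -[n n1 [[u Uu ux] [v Vv vx]]].
  by exists n => //; exists (u, v) => //; rewrite /prod_fun ux vx.
- move=> fD x O [p Op] oO.
  (* [A] and [B] are merely neighbourhoods of the coordinates of [p]; their interiors give an opene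
     box inside [O]. *)
  have [[A B] /= [Ap Bp] ABO] : nbhs p O by exact: open_nbhs_nbhs.
  have oA : opene (interior A) by split; [exists p.1 | exact: open_interior].
  have oB : opene (interior B) by split; [exists p.2 | exact: open_interior].
  have [n n1 [q [Aq Bq] qx]] := fD _ _ oA oB (x, x) erefl.
  exists q; split; first by apply: ABO; split; exact: interior_subset.
  by exists n; rewrite compose_prod_seq.
- move=> fd x U V [[u Uu] oU] [[v Vv] oV].
  (* Conversely, an opene box is itself a nonempty open set, so it meets the dense negative
     orbit. *)
  have oUV : open (U `*` V).
    rewrite openE => -[a b] [Ua Vb].
    by exists (U, V) => //; split; exact: open_nbhs_nbhs.
  have UV0 : U `*` V !=set0 by exists (u, v).
  have [q [[Uq Vq]]] := fd x _ UV0 oUV.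
  rewrite negative_orbit_prod_seq => -[n [n1 [q1x q2x]]].
  by exists n; split => //; split; [exists q.1 | exists q.2].
- move=> fN U V oU oV; apply/seteqP; split=> // x _.
  by have [n [n1 UVx]] := fN x U V oU oV; exists n.
Qed.
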